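(* The set of roots $\Delta$ of $(\mathfrak{e}_{6,\mathbb{R}})^{\mathbb{C}}$ relative to the Cartan subalgebra $\mathfrak{h}_6$ is $$\Delta=\left\{\pm\tfrac12(\tau_2-\tau_3),\ \pm\tfrac12(\tau_3-\tau_1),\ \pm\tfrac12(\tau_1-\tau_2)\right\}.$$
   Context: Let $(\mathfrak{J}_{\mathbb{R}})^{\mathbb{C}}$ be the space of symmetric $3\times3$ complex matrices with $X\circ Y=\frac12(XY+YX)$, $(X,Y)=\mathrm{tr}(X\circ Y)$, $X\times Y=\frac12\bigl(2X\circ Y-\mathrm{tr}(X)Y-\mathrm{tr}(Y)X+(\mathrm{tr}(X)\mathrm{tr}(Y)-(X,Y))E\bigr)$. Let $(\mathfrak{e}_{6,\mathbb{R}})^{\mathbb{C}}=\{\phi\in\mathrm{Hom}_{\mathbb{C}}((\mathfrak{J}_{\mathbb{R}})^{\mathbb{C}})\mid(\phi X,X\times X)=0\ \forall X\}$ with commutator bracket ($\mathrm{Hom}_{\mathbb{C}}(V)$ denotes $\mathbb{C}$-linear endomorphisms of $V$). For $T\in(\mathfrak{J}_{\mathbb{R}})^{\mathbb{C}}$ let $\tilde TX=T\circ X$. Let $E_i$ be the diagonal matrix with $1$ in position $(i,i)$ and $0$ elsewhere. The Cartan subalgebra $\mathfrak{h}_6$ consists of the elements $\tilde T_0$ with $T_0=\tau_1E_1+\tau_2E_2+\tau_3E_3$, $\tau_i\in\mathbb{C}$, $\tau_1+\tau_2+\tau_3=0$; the $\tau_i$ are regarded as linear functionals on $\mathfrak{h}_6$.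 *)

(* Defs.v *)
From HB Require Import structures.
From mathcomp Require Import all_boot all_order all_algebra.
From mathcomp Require Import complex.
From mathcomp Require Import boolp classical_sets reals.

Set Implicit Arguments.
Unset Strict Implicit.
Unset Printing Implicit Defensive.

Import GRing.Theory Num.Theory.

Local Open Scope ring_scope.
Local Open Scope classical_set_scope.

Definition commutator (F : fieldType) (V : vectType F) (f g : 'End(V)) :
  'End(V) := ((f \o g) - (g \o f))%VF.

Lemma commutatorE (F : fieldType) (V : vectType F) (f g : 'End(V)) (x : V) :
  commutator f g x = f (g x) - g (f x).
Proof. by rewrite /commutator add_lfunE opp_lfunE !comp_lfunE. Qed.

Section Roots.
Variables (F : fieldType) (V : vectType F).
Variables (g : set 'End(V)) (h : {vspace 'End(V)}).

(* g stands for a Lie algebra of endomorphisms of V under the commutator. *)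
Definition root_space (alpha : 'Hom(subvs_of h, F^o)) : set 'End(V) :=
  [set phi | g phi /\
     forall H : subvs_of h, commutator (vsval H) phi = (alpha H : F) *: phi].

Definition lie_roots : set 'Hom(subvs_of h, F^o) :=
  [set alpha | alpha <> 0 /\ exists2 phi, root_space alpha phi & phi <> 0].

End Roots.
Arguments lie_roots {F V} g h _.

Section Jordan.
Variable R : realType.
Local Notation C := R[i].

Definition trmx_sub (A : 'M[C]_3) : 'M[C]_3 := A^T - A.

Lemma trmx_sub_is_linear : linear trmx_sub.
Proof.
by move=> a A B; rewrite /trmx_sub linearP /= scalerBr opprD addrACA.
Qed.
HB.instance Definition _ :=
  GRing.isLinear.Build C 'M[C]_3 'M[C]_3 _ trmx_sub trmx_sub_is_linear.

Definition symmx : {vspace 'M[C]_3} := lker (linfun trmx_sub).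

Lemma mem_symmx (A : 'M[C]_3) : (A \in symmx) = (A^T == A).
Proof. by rewrite memv_ker lfunE /= subr_eq0. Qed.

Definition J := subvs_of symmx.
HB.instance Definition _ := Vector.copy J (subvs_of symmx).

Definition mxJ (X : J) : 'M[C]_3 := vsval X.

Lemma mxJ_sym (X : J) : (mxJ X)^T = mxJ X.
Proof. by apply/eqP; rewrite -mem_symmx; exact: subvsP. Qed.

Lemma mxJ_inj : injective mxJ.
Proof. exact: val_inj. Qed.

Lemma mxJ_is_linear : linear mxJ.
Proof. exact: linearP. Qed.
HB.instance Definition _ := GRing.isLinear.Build C J 'M[C]_3 _ mxJ mxJ_is_linear.

Fact jordan_subproof (X Y : J) :
  2^-1 *: (mxJ X *m mxJ Y + mxJ Y *m mxJ X) \in symmx.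
Proof.
by rewrite mem_symmx linearZ linearD /= !trmx_mul !mxJ_sym addrC.
Qed.
Definition jordan (X Y : J) : J := Subvs (jordan_subproof X Y).

Lemma jordanE (X Y : J) :
  mxJ (jordan X Y) = 2^-1 *: (mxJ X *m mxJ Y + mxJ Y *m mxJ X).
Proof. by []. Qed.

Fact oneJ_subproof : (1%:M : 'M[C]_3) \in symmx.
Proof. by rewrite mem_symmx trmx1. Qed.
Definition oneJ : J := Subvs oneJ_subproof.

Fact diagE_subproof (i : 'I_3) : (delta_mx i i : 'M[C]_3) \in symmx.
Proof. by rewrite mem_symmx trmx_delta. Qed.
Definition diagE (i : 'I_3) : J := Subvs (diagE_subproof i).

Definition trJ (X : J) : C := \tr (mxJ X).

Definition innerJ (X Y : J) : C := trJ (jordan X Y).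

Definition crossJ (X Y : J) : J :=
  2^-1 *: (2 *: jordan X Y - trJ X *: Y - trJ Y *: X
           + (trJ X * trJ Y - innerJ X Y) *: oneJ).

Definition e6 : set 'End(J) :=
  [set phi | forall X : J, innerJ (phi X) (crossJ X X) = 0].

Lemma jordan_is_linear (T : J) : linear (jordan T).
Proof.
move=> a X Y; apply: mxJ_inj.
rewrite mxJ_is_linear !jordanE mxJ_is_linear mulmxDr mulmxDl.
by rewrite -scalemxAr -scalemxAl addrACA -scalerDr !scalerDr !scalerA !(mulrC a).
Qed.
HB.instance Definition _ (T : J) :=
  GRing.isLinear.Build C J J _ (jordan T) (jordan_is_linear T).

Definition tilde (T : J) : 'End(J) := linfun (jordan T).

Lemma tildeE (T X : J) : tilde T X = jordan T X.
Proof. exact: lfunE. Qed.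

Definition diagJ (t : 'rV[C]_3) : J := \sum_i t 0 i *: diagE i.

Definition rV_sum (t : 'rV[C]_3) : C^o := \sum_i t 0 i.

Definition cartan_elt (t : 'rV[C]_3) : 'End(J) := tilde (diagJ t).

Definition h6 : {vspace 'End(J)} :=
  (linfun cartan_elt @: lker (linfun rV_sum))%VS.

(* An element of h6 is X |-> T0 o X for a unique diagonal T0, which is
   recovered as its value at the identity matrix; see tauE. *)
Definition coordT (i : 'I_3) (H : subvs_of h6) : C^o := mxJ (vsval H oneJ) i i.

Definition tau (i : 'I_3) : 'Hom(subvs_of h6, C^o) := linfun (coordT i).

Lemma jordanC (X Y : J) : jordan X Y = jordan Y X.
Proof. by apply: mxJ_inj; rewrite !jordanE addrC. Qed.

Lemma jordan1 (T : J) : jordan T oneJ = T.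
Proof.
apply: mxJ_inj; rewrite jordanE mulmx1 mul1mx -mulr2n -(scaler_nat _ (mxJ T)) scalerA.
by rewrite mulVf ?scale1r // pnatr_eq0.
Qed.

Lemma cartan_elt_is_linear : linear cartan_elt.
Proof.
move=> a s t; apply/lfunP => X; rewrite add_lfunE scale_lfunE !tildeE.
rewrite !(jordanC _ X) -linearP /=; congr (jordan X _).
rewrite /diagJ scaler_sumr -big_split /=; apply: eq_bigr => i _.
by rewrite !mxE scalerDl scalerA.
Qed.
HB.instance Definition _ := GRing.isLinear.Build C 'rV[C]_3 'End(J) _
  cartan_elt cartan_elt_is_linear.

Lemma rV_sum_is_linear : linear rV_sum.
Proof.
move=> a s t; rewrite /rV_sum scaler_sumr -big_split /=.
by apply: eq_bigr => i _; rewrite !mxE.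
Qed.
HB.instance Definition _ :=
  GRing.isLinear.Build C 'rV[C]_3 C^o _ rV_sum rV_sum_is_linear.

Lemma mem_h6P (H : 'End(J)) :
  reflect (exists2 t : 'rV[C]_3, \sum_i t 0 i = 0
             & H = tilde (\sum_i t 0 i *: diagE i))
          (H \in h6).
Proof.
apply: (iffP memv_imgP) => -[t].
  by rewrite memv_ker !lfunE /= => /eqP t0 ->; exists t.
by move=> t0 ->; exists t; rewrite ?memv_ker ?lfunE //=; apply/eqP.
Qed.

Lemma coordT_is_linear (i : 'I_3) : linear (coordT i).
Proof.
move=> a H K; rewrite /coordT.
by rewrite (linearP (@vsval C _ h6)) add_lfunE scale_lfunE linearP /= !mxE.
Qed.
HB.instance Definition _ (i : 'I_3) := GRing.isLinear.Build C (subvs_of h6) C^o _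
  (coordT i) (coordT_is_linear i).

Lemma tauE (H : subvs_of h6) (t : 'rV[C]_3) (i : 'I_3) :
  vsval H = tilde (\sum_j t 0 j *: diagE j) -> tau i H = t 0 i.
Proof.
move=> Ht; rewrite lfunE /= /coordT Ht tildeE jordan1 linear_sum summxE /=.
rewrite (bigD1 i) //= big1 ?addr0 => [|j ji]; rewrite !mxE ?eqxx ?mulr1 //.
by rewrite eq_sym (negPf ji) mulr0.
Qed.

End Jordan.

(* Main.v *)
(** The cubic form [(phi X, X * X)] is the derivative of [det] along [phi X], so
    it only involves the 2x2 minors of [X].  Let [S_cd] denote the symmetrized
    matrix units, which are common eigenvectors of [h6] with weights
    [(tau_c + tau_d) / 2].  If [phi] is a root vector and the [(a, b)] entry of
    [phi S_cd] is nonzero, the root is [(tau_a + tau_b - tau_c - tau_d) / 2].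
    Testing the cubic form on a few sparse matrices [X] shows that this entry
    vanishes whenever [{a, b}] and [{c, d}] are disjoint, so two indices cancel
    and the root is [(tau_i - tau_j) / 2] with [i <> j].  Conversely,
    [X |-> A X + X A^T] with [A] the [(i, j)] matrix unit is a root vector. *)
Require Import Defs.
From HB Require Import structures.
From mathcomp Require Import all_boot all_order all_algebra.
From mathcomp Require Import complex ring.
From mathcomp Require Import boolp classical_sets reals.

Import GRing.Theory Num.Theory.
Local Open Scope ring_scope.
Local Open Scope classical_set_scope.

(** * Triples of distinct indices in ['I_3] *)

Lemma ord3_third (i j : 'I_3) : i != j -> exists k, (k != i) && (k != j).
Proof.
move=> ij; have : (0 < #|~: [set i; j]%SET|)%N.
  by rewrite -(ltn_add2l #|[set i; j]%SET|) cardsC card_ord cards2 ij.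
by case/card_gt0P => k; rewrite !inE negb_or; exists k.
Qed.

Lemma perm_enum_ord3 (i j k : 'I_3) :
  i != j -> k != i -> k != j -> perm_eq (enum 'I_3) [:: i; j; k].
Proof.
move=> ij ki kj.
have us : uniq [:: i; j; k].
  by rewrite /= !inE negb_or ij ![_ == k]eq_sym ki kj.
have [_ eqs] : (size [:: i; j; k] = size (enum 'I_3)) *
    ([:: i; j; k] =i enum 'I_3).
  by apply: uniq_min_size; rewrite ?size_enum_ord // => x _; rewrite mem_enum.
by rewrite uniq_perm ?enum_uniq // => x; rewrite eqs.
Qed.

Lemma ord3_third_unique (i j k l : 'I_3) :
  i != j -> k != i -> k != j -> l != i -> l != j -> l = k.
Proof.
move=> ij ki kj /negbTE li /negbTE lj.
have := perm_mem (perm_enum_ord3 i j k ij ki kj) l.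
by rewrite mem_enum !inE li lj => /esym/eqP.
Qed.

Lemma sum_ord3 (V : nmodType) (f : 'I_3 -> V) (i j k : 'I_3) :
  i != j -> k != i -> k != j -> \sum_x f x = f i + f j + f k.
Proof.
move=> ij ki kj; rewrite -big_enum (perm_big _ (perm_enum_ord3 i j k _ _ _)) //=.
by rewrite !big_cons big_nil addr0 addrA.
Qed.

(* Both sides are [tr (B adj A)]: on the left [adj A] is written by
   Cayley-Hamilton, on the right by its 2x2 minors. *)
Lemma mxtrace_adj (F : fieldType) (A B : 'M[F]_3) (i j k : 'I_3) :
  (2 : F) != 0 -> i != j -> k != i -> k != j -> A^T = A -> B^T = B ->
  \tr (B *m (A *m A)) - \tr A * \tr (B *m A)
    + 2^-1 * (\tr A ^+ 2 - \tr (A *m A)) * \tr B =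
    B i i * (A j j * A k k - A j k ^+ 2)
  + B j j * (A i i * A k k - A i k ^+ 2)
  + B k k * (A i i * A j j - A i j ^+ 2)
  + 2 * B i j * (A i k * A j k - A i j * A k k)
  + 2 * B i k * (A i j * A j k - A i k * A j j)
  + 2 * B j k * (A i j * A i k - A j k * A i i).
Proof.
move=> F2 ij ki kj symA symB.
have AC x y : A x y = A y x by rewrite -[in LHS]symA mxE.
have BC x y : B x y = B y x by rewrite -[in LHS]symB mxE.
have mE (M N : 'M[F]_3) x y :
    (M *m N) x y = M x i * N i y + M x j * N j y + M x k * N k y.
  by rewrite mxE (sum_ord3 _ _ i j k ij ki kj).
have tE (M : 'M[F]_3) : \tr M = M i i + M j j + M k k.
  by rewrite /mxtrace (sum_ord3 _ _ i j k ij ki kj).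
rewrite !tE !mE (AC j i) (AC k i) (AC k j) (BC j i) (BC k i) (BC k j).
by field.
Qed.

Section Roots.
Variable R : realType.
Local Notation C := R[i].
Local Notation J := (J R).
Implicit Types (X Y : J) (i j k a b c d : 'I_3) (H : subvs_of (h6 R)).

(** * Entries of Jordan matrices and the cubic form *)

Lemma neq20 : (2 : C) != 0.
Proof. by rewrite pnatr_eq0. Qed.

Lemma mxJC X i j : mxJ X i j = mxJ X j i.
Proof. by rewrite -[in LHS](mxJ_sym X) mxE. Qed.

Lemma mxJD X Y : mxJ (X + Y) = mxJ X + mxJ Y.
Proof. exact: linearD. Qed.

Lemma mxJN X : mxJ (- X) = - mxJ X.
Proof. exact: linearN. Qed.

Lemma mxJZ (z : C) X : mxJ (z *: X) = z *: mxJ X.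
Proof. exact: linearZ. Qed.

Lemma mxJDE X Y i j : mxJ (X + Y) i j = mxJ X i j + mxJ Y i j.
Proof. by rewrite mxJD mxE. Qed.

Lemma mxJNE X i j : mxJ (- X) i j = - mxJ X i j.
Proof. by rewrite mxJN mxE. Qed.

Lemma mxJZE (z : C) X i j : mxJ (z *: X) i j = z * mxJ X i j.
Proof. by rewrite mxJZ mxE. Qed.

Lemma innerJE X Y : innerJ X Y = \tr (mxJ X *m mxJ Y).
Proof.
rewrite /innerJ /trJ jordanE mxtraceZ mxtraceD (mxtrace_mulC (mxJ Y)).
by rewrite -mulr2n -[X in _ * X]mulr_natl mulKf ?neq20.
Qed.

Lemma jordan_sqr X : mxJ (jordan X X) = mxJ X *m mxJ X.
Proof.
by rewrite jordanE -mulr2n -[X in _ *: X]scaler_nat scalerA mulVf ?neq20 ?scale1r.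
Qed.

(** By Cayley-Hamilton the right-hand side is the adjugate of [X]. *)
Lemma mxJ_cross X : mxJ (crossJ X X) = mxJ X *m mxJ X - trJ X *: mxJ X
   + (2^-1 * (trJ X ^+ 2 - \tr (mxJ X *m mxJ X)))%:M.
Proof.
rewrite /crossJ innerJE !(mxJD, mxJN, mxJZ) jordan_sqr /= -(addrA (2 *: _)) -opprD.
rewrite -mulr2n -[X in _ - X]scaler_nat !scalerDr !scalerN !scalerA.
by rewrite mulVf ?neq20 // scale1r mul1r scalemx1 expr2.
Qed.

Lemma innerJ_cross X Y i j k : i != j -> k != i -> k != j ->
  innerJ Y (crossJ X X) =
    mxJ Y i i * (mxJ X j j * mxJ X k k - mxJ X j k ^+ 2)
  + mxJ Y j j * (mxJ X i i * mxJ X k k - mxJ X i k ^+ 2)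
  + mxJ Y k k * (mxJ X i i * mxJ X j j - mxJ X i j ^+ 2)
  + 2 * mxJ Y i j * (mxJ X i k * mxJ X j k - mxJ X i j * mxJ X k k)
  + 2 * mxJ Y i k * (mxJ X i j * mxJ X j k - mxJ X i k * mxJ X j j)
  + 2 * mxJ Y j k * (mxJ X i j * mxJ X i k - mxJ X j k * mxJ X i i).
Proof.
move=> ij ki kj; rewrite -mxtrace_adj ?neq20 ?mxJ_sym //.
rewrite innerJE mxJ_cross mulmxDr mulmxBr -scalemxAr mul_mx_scalar.
by rewrite mxtraceD raddfB /= !mxtraceZ.
Qed.

(** * Symmetrized matrix units and their weights *)

Fact symE_subproof i j : (delta_mx i j + delta_mx j i : 'M[C]_3) \in symmx R.
Proof. by rewrite mem_symmx linearD /= !trmx_delta addrC. Qed.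

(** For [i = j] this is twice a diagonal matrix unit, which accounts for some of the powers of 2
    below. *)
Definition symE i j : J := Subvs (symE_subproof i j).

Lemma symEE i j a b :
  mxJ (symE i j) a b =
    ((a == i) && (b == j))%:R + ((a == j) && (b == i))%:R.
Proof. by rewrite /mxJ /= !mxE. Qed.

Lemma symE_span X : X = \sum_i \sum_j (2^-1 * mxJ X i j) *: symE i j.
Proof.
apply: mxJ_inj; rewrite linear_sum; apply/matrixP => a b; rewrite summxE.
under eq_bigr => i _ do rewrite linear_sum summxE.
under eq_bigr => i _ do under eq_bigr => j _ do
  rewrite linearZ mxE symEE mulrDr.
under eq_bigr => i _ do rewrite big_split.
rewrite big_split /= (bigD1 a) //= (bigD1 b) //= !eqxx mulr1.
rewrite [X in _ + X + _]big1 ?addr0; last first.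
  move=> i ia; rewrite big1 // => j _.
  by rewrite eq_sym (negbTE ia) mulr0.
rewrite [X in _ + X + _]big1 ?addr0; last first.
  by move=> j jb; rewrite [b == j]eq_sym (negbTE jb) mulr0.
rewrite (bigD1 b) //= (bigD1 a) //= !eqxx mulr1.
rewrite [X in _ + (_ + _ + X)]big1 ?addr0; last first.
  move=> i ib; rewrite big1 // => j _.
  by rewrite [b == i]eq_sym (negbTE ib) andbF mulr0.
rewrite [X in _ + (_ + X)]big1 ?addr0; last first.
  by move=> j ja; rewrite [a == j]eq_sym (negbTE ja) mulr0.
by rewrite (mxJC X b a); field.
Qed.

(** For diagonal [T], [(T X + X T) / 2] scales the [(a, b)] entry by the mean of two diagonal
    entries, so matrix entries are weight coordinates. *)
Lemma h6_entry H X a b :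
  mxJ (vsval H X) a b = 2^-1 * (tau R a H + tau R b H) * mxJ X a b.
Proof.
have /mem_h6P[t t0 Ht] := subvsP H.
rewrite !(tauE _ Ht) Ht tildeE jordanE.
have dT : mxJ (\sum_i t 0 i *: diagE R i) = diag_mx t.
  rewrite linear_sum; apply/matrixP => x y; rewrite summxE mxE (bigD1 x) //=.
  rewrite big1 => [|z zx]; rewrite !mxE.
    by rewrite eqxx addr0 mulr_natr [y == x]eq_sym.
  by rewrite [x == z]eq_sym (negbTE zx) mulr0.
rewrite dT mul_diag_mx mul_mx_diag !mxE.
by ring.
Qed.

Lemma h6_symE H c d :
  vsval H (symE c d) = (2^-1 * (tau R c H + tau R d H)) *: symE c d.
Proof.
apply: mxJ_inj; apply/matrixP => a b; rewrite h6_entry mxJZE symEE.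
rewrite !mulrDr; congr (_ + _).
  by case: andP => [[/eqP-> /eqP->]|_] //=; rewrite !mulr0.
by case: andP => [[/eqP-> /eqP->]|_] /=; rewrite ?mulr0 //; ring.
Qed.

Lemma neqF i j : i != j -> ((i == j) = false) * ((j == i) = false).
Proof. by move=> ij; rewrite [j == i]eq_sym (negbTE ij). Qed.

(** * Vanishing entries for elements of [e6] *)

Lemma e6_symE_diag (phi : 'End(J)) a c d : e6 phi ->
  a != c -> a != d -> mxJ (phi (symE c d)) a a = 0.
Proof.
move=> ephi ac ad; have [cd|cd] := eqVneq c d; last first.
  (* The adjugate of [symE c d] is minus the [(a, a)] matrix unit. *)
  have := ephi (symE c d); rewrite (innerJ_cross _ _ c d a) //.
  rewrite !symEE !eqxx !(neqF _ _ ac, neqF _ _ ad, neqF _ _ cd) /= => h.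
  by apply: oppr_inj; rewrite oppr0 -[RHS]h; ring.
subst d; have [k /andP[ka kc]] := ord3_third a c ac.
have [ck ak] : c != k /\ a != k by rewrite ![_ == k]eq_sym.
(* The adjugate of [symE c c] is zero; adding [z *: symE k k] turns it into [4 * z] times the
   [(a, a)] matrix unit. *)
have h (z : C) : 4 * z * (mxJ (phi (symE c c)) a a
                          + z * mxJ (phi (symE k k)) a a) = 0.
  have phiE : phi (symE c c + z *: symE k k) = phi (symE c c) + z *: phi (symE k k).
    by rewrite addrC linearP addrC.
  have XE x y : mxJ (symE c c + z *: symE k k) x y =
      mxJ (symE c c) x y + z * mxJ (symE k k) x y by rewrite mxJDE mxJZE.
  have := ephi (symE c c + z *: symE k k).
  rewrite (innerJ_cross _ _ c k a ck ac ak) phiE !(mxJDE (phi _)) !mxJZE.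
  move: (symE c c + _) XE => X XE; rewrite !XE !symEE.
  rewrite !eqxx !(neqF _ _ ac, neqF _ _ ka, neqF _ _ kc) /= => hz.
  by rewrite -[RHS]hz; ring.
(* Subtracting [h] at [-1] from [h] at [1] cancels the even powers of [z] and leaves 8 times the
   wanted entry. *)
apply: (mulfI (_ : 8 != 0)); first by rewrite pnatr_eq0.
rewrite mulr0 -[RHS]subr0 -[X in _ = X - _](h 1) -[X in _ = _ - X](h (-1)).
by ring.
Qed.

Lemma e6_symE_offdiag (phi : 'End(J)) a b c : e6 phi ->
  a != b -> c != a -> c != b -> mxJ (phi (symE c c)) a b = 0.
Proof.
(* This entry would contribute a [z ^+ 3] term to [h], which the difference at [1] and [-1] would
   not cancel. *)
move=> ephi ab ca cb; have q0 := e6_symE_diag phi c a b ephi ca cb.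
have h (z : C) : z ^+ 2 * mxJ (phi (symE c c)) c c
    + 4 * z * (mxJ (phi (symE c c)) a b + z * mxJ (phi (symE a b)) a b) = 0.
  have phiE : phi (symE c c + z *: symE a b) = phi (symE c c) + z *: phi (symE a b).
    by rewrite addrC linearP addrC.
  have XE x y : mxJ (symE c c + z *: symE a b) x y =
      mxJ (symE c c) x y + z * mxJ (symE a b) x y by rewrite mxJDE mxJZE.
  have := ephi (symE c c + z *: symE a b).
  rewrite (innerJ_cross _ _ a b c ab ca cb) phiE !(mxJDE (phi _)) !mxJZE q0.
  move: (symE c c + _) XE => X XE; rewrite !XE !symEE.
  rewrite !eqxx !(neqF _ _ ab, neqF _ _ ca, neqF _ _ cb) /= => hz.
  by apply: oppr_inj; rewrite oppr0 -[RHS]hz; ring.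
apply: (mulfI (_ : 8 != 0)); first by rewrite pnatr_eq0.
rewrite mulr0 -[RHS]subr0 -[X in _ = X - _](h 1) -[X in _ = _ - X](h (-1)).
by ring.
Qed.

(** With only three indices, disjointness forces [a = b] or [c = d]. *)
Lemma e6_symE_disjoint (phi : 'End(J)) a b c d : e6 phi ->
  a != c -> a != d -> b != c -> b != d -> mxJ (phi (symE c d)) a b = 0.
Proof.
move=> ephi ac ad bc bd; have [<-|ab] := eqVneq a b; first exact: e6_symE_diag.
have -> : d = c by apply: (ord3_third_unique a b c d ab); rewrite // eq_sym.
by apply: e6_symE_offdiag; rewrite // eq_sym.
Qed.

(** * Every root is half a difference *)

Lemma half_tau_subE i j H : (2^-1 *: (tau R i - tau R j)) H =
  2^-1 * (tau R i H - tau R j H) :> C.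
Proof. by rewrite scale_lfunE add_lfunE opp_lfunE. Qed.

Lemma lie_roots_sub alpha : lie_roots (@e6 R) (h6 R) alpha ->
  exists i j, i != j /\ alpha = 2^-1 *: (tau R i - tau R j).
Proof.
move=> [alpha0 [phi [ephi wphi] phi0]].
have [c [d [a [b pcd]]]] : exists c d a b, mxJ (phi (symE c d)) a b != 0.
  apply: contrapT => p0; apply: phi0; apply/lfunP => X; rewrite zero_lfunE.
  rewrite [X]symE_span linear_sum big1 // => c _; rewrite linear_sum big1 // => d _.
  rewrite linearZ /= (_ : phi _ = 0) ?scaler0 //.
  apply: mxJ_inj; apply/matrixP => a b; rewrite linear0 mxE; apply/eqP.
  by apply/negPn/negP => pn; apply: p0; exists c, d, a, b.
(* The root equation is applied to [symE c d] and read at entry [(a, b)], where [H] acts by scalars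
   before and after [phi]; the nonzero entry then cancels. *)
have alphaE H :
    alpha H = 2^-1 * (tau R a H + tau R b H - (tau R c H + tau R d H)) :> C.
  apply: (mulIf pcd); have /lfunP/(_ (symE c d)) := wphi H.
  rewrite commutatorE h6_symE linearZ scale_lfunE => /(congr1 (fun X => mxJ X a b)).
  rewrite mxJDE mxJNE !mxJZE h6_entry => <-.
  by rewrite -mulrBl mulrBr.
have root_of i j : (forall H, alpha H = 2^-1 * (tau R i H - tau R j H) :> C) ->
    exists i j, i != j /\ alpha = 2^-1 *: (tau R i - tau R j).
  move=> aE; exists i, j; split; last by apply/lfunP => H; rewrite half_tau_subE.
  apply/eqP => ij; apply: alpha0; apply/lfunP => H; rewrite aE ij subrr mulr0.
  by rewrite zero_lfunE.
(* A shared index cancels its [tau]; if none is shared, [pcd] is contradicted. *)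
have [ac|ac] := eqVneq a c.
  by apply: (root_of b d) => H; rewrite alphaE ac; ring.
have [ad|ad] := eqVneq a d.
  by apply: (root_of b c) => H; rewrite alphaE ad; ring.
have [bc|bc] := eqVneq b c.
  by apply: (root_of a d) => H; rewrite alphaE bc; ring.
have [bd|bd] := eqVneq b d.
  by apply: (root_of a c) => H; rewrite alphaE bd; ring.
by rewrite e6_symE_disjoint ?eqxx in pcd.
Qed.

(** * Root vectors for each half difference *)

Fact sym_act_subproof (A : 'M[C]_3) X : A *m mxJ X + mxJ X *m A^T \in symmx R.
Proof.
by rewrite mem_symmx linearD /= !trmx_mul trmxK mxJ_sym addrC.
Qed.

(** Derivative at the identity of the congruence action [g X g^T]. *)
Definition sym_act (A : 'M[C]_3) X : J := Subvs (sym_act_subproof A X).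

Lemma sym_actE A X : mxJ (sym_act A X) = A *m mxJ X + mxJ X *m A^T.
Proof. by []. Qed.

Lemma sym_act_is_linear A : linear (sym_act A).
Proof.
move=> z X Y; apply: mxJ_inj; rewrite mxJD mxJZ !sym_actE mxJD mxJZ.
rewrite mulmxDr mulmxDl scalerDr.
by rewrite -scalemxAr -scalemxAl addrACA.
Qed.
HB.instance Definition _ A :=
  GRing.isLinear.Build C J J _ (sym_act A) (sym_act_is_linear A).

Lemma sym_act_deltaE i j X a b :
  mxJ (linfun (sym_act (delta_mx i j)) X) a b =
    (a == i)%:R * mxJ X j b + (b == i)%:R * mxJ X a j.
Proof.
rewrite lfunE [mxJ _]sym_actE trmx_delta !mxE.
rewrite (bigD1 j) //= big1 => [|k kj]; last first.
  by rewrite mxE (negbTE kj) andbF mul0r.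
rewrite (bigD1 j) //= big1 => [|k kj]; last first.
  by rewrite mxE (negbTE kj) mulr0.
by rewrite !mxE !eqxx andbT !addr0 [mxJ X a j * _]mulrC.
Qed.

(** For [sym_act A] the cubic form equals [2 tr(A) det(X)], and an off-diagonal matrix unit has
    trace zero. *)
Lemma sym_act_delta_e6 i j : i != j -> e6 (linfun (sym_act (delta_mx i j))).
Proof.
move=> ij X; have [k /andP[ki kj]] := ord3_third i j ij.
rewrite (innerJ_cross _ _ i j k) // !sym_act_deltaE.
rewrite !eqxx !(neqF _ _ ij, neqF _ _ ki, neqF _ _ kj) /= (mxJC X j i).
by ring.
Qed.

Lemma lie_roots_half_tau i j : i != j ->
  lie_roots (@e6 R) (h6 R) (2^-1 *: (tau R i - tau R j)).
Proof.
move=> ij; split=> [alpha0|].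
  (* On this traceless diagonal the functional takes the value [(1 - (-1)) / 2 = 1]. *)
  pose t : 'rV[C]_3 := delta_mx 0 i - delta_mx 0 j.
  have t0 : \sum_k t 0 k = 0.
    have [k /andP[ki kj]] := ord3_third i j ij.
    rewrite (sum_ord3 _ _ i j k) // !mxE !eqxx.
    by rewrite !(neqF _ _ ij, neqF _ _ ki, neqF _ _ kj) /=; ring.
  have Ht : tilde (\sum_k t 0 k *: diagE R k) \in h6 R.
    by apply/mem_h6P; exists t.
  have /lfunP/(_ (Subvs Ht)) := alpha0.
  rewrite half_tau_subE zero_lfunE !(tauE (t := t) _) // !mxE !eqxx !(neqF _ _ ij) /=.
  rewrite (_ : _ * _ = 1); last by field.
  by move/eqP; rewrite oner_eq0.
exists (linfun (sym_act (delta_mx i j))); last first.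
  move=> /lfunP/(_ (symE j j))/(congr1 (fun X => mxJ X i j)).
  rewrite zero_lfunE linear0 mxE sym_act_deltaE !symEE !eqxx !(neqF _ _ ij) /=.
  by move/eqP; rewrite mul1r mul0r addr0 (negbTE neq20).
split=> [|H]; first exact: sym_act_delta_e6.
apply/lfunP => X; rewrite commutatorE scale_lfunE half_tau_subE.
apply: mxJ_inj; apply/matrixP => a b.
(* Replacing an index [j] by [i] shifts the weight by [(tau_i - tau_j) / 2]. *)
rewrite mxJDE mxJNE mxJZE h6_entry !sym_act_deltaE !h6_entry.
by have [->|_] := eqVneq a i; have [->|_] := eqVneq b i => /=; ring.
Qed.

End Roots.

Theorem theorem4p10 (R : realType) :
  let tau1 := tau R (@Ordinal 3 0 isT) in
  let tau2 := tau R (@Ordinal 3 1 isT) in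
  let tau3 := tau R (@Ordinal 3 2 isT) in
  lie_roots (@e6 R) (h6 R) =
    [set 2^-1 *: (tau2 - tau3); - (2^-1 *: (tau2 - tau3));
         2^-1 *: (tau3 - tau1); - (2^-1 *: (tau3 - tau1));
         2^-1 *: (tau1 - tau2); - (2^-1 *: (tau1 - tau2))].
Proof.
(* Negation swaps the two terms of a difference, so the six functionals correspond to the ordered
   pairs of distinct indices. *)
move=> tau1 tau2 tau3; rewrite -!scalerN !opprB.
apply/seteqP; split=> alpha.
  move=> /lie_roots_sub[i [j [ij ->]]].
  have ordE (k : 'I_3) : [\/ k = @Ordinal 3 0 isT, k = @Ordinal 3 1 isT
                           | k = @Ordinal 3 2 isT].
    by case: k => [[|[|[|k]]] kP] //;
      [apply: Or31 | apply: Or32 | apply: Or33]; apply: val_inj.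
  by case: (ordE i) ij => ->; case: (ordE j) => -> // _; do ?[by right | left].
by move=> [[[[[->|->]|->]|->]|->]|->]; apply: lie_roots_half_tau.
Qed.
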